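(* Let $n > 51$ be an integer such that none of $n$, $n-1$, $n-2$, $n/2$, $(n-1)/2$, $(n-2)/2$ is a prime number. Suppose that $\mathcal{P}^*(A_n)$ is connected, and let $p$ be the maximum prime factor of $n(n-1)(n-2)$. Then: (1) if $\left[\frac{n-2}{p}\right] \geq 3p+2$, then $6 \leq \mathrm{diam}(\mathcal{P}^*(A_n)) \leq 8$; (2) otherwise, $6 \leq \mathrm{diam}(\mathcal{P}^*(A_n)) \leq 11$.
   Context: $A_n$ is the alternating group on $\{1,\dots,n\}$. For a finite group $G$, the power graph $\mathcal{P}(G)$ is the simple undirected graph with vertex set $G$ in which two distinct elements $x \neq y$ are adjacent if and only if $y = x^m$ or $x = y^m$ for some positive integer $m$. The proper power graph $\mathcal{P}^*(G)$ is the graph obtained from $\mathcal{P}(G)$ by deleting the vertex $1$ (the identity element). For a connected graph $\Gamma$, the distance between two vertices is the length (number of edges) of a shortest path joining them, and $\mathrm{diam}(\Gamma)$ is the maximum distance between pairs of vertices. $[x]$ denotes the integer part (floor) of $x$. *)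

(* Defs.v *)
From mathcomp Require Import all_boot all_fingroup all_solvable.

Set Implicit Arguments.
Unset Strict Implicit.
Unset Printing Implicit Defensive.

Local Open Scope group_scope.

(* A finite simple graph is given by a symmetric irreflexive adjacency
   relation on a finite type of vertices. *)
Section Graph.

Variables (T : finType) (e : rel T).

Definition connected_graph := forall x y : T, connect e x y.

Definition has_walk (x y : T) (k : nat) : bool :=
  [exists w : k.-tuple T, path e x w && (last x w == y)].

(* The least length of a walk from x to y. Between connected vertices this
   length is smaller than the number of vertices, which is also the (junk)
   value between disconnected vertices. *)
Definition dist (x y : T) : nat := find (has_walk x y) (iota 0 #|T|).

Definition diam : nat := \max_(x : T) \max_(y : T) dist x y.

Lemma has_walkP x y k :
  reflect (exists w : seq T, [/\ size w = k, path e x w & last x w = y])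
          (has_walk x y k).
Proof.
apply: (iffP existsP) => [[w /andP[ew /eqP lw]] | [w [sw ew lw]]].
  by exists w; rewrite size_tuple.
by exists (tcast sw (in_tuple w)); rewrite val_tcast ew lw eqxx.
Qed.

Lemma dist_walk x y : connect e x y -> has_walk x y (dist x y).
Proof.
case/connectP=> w0 /shortenP[w ew Uw _] ->{w0}.
have ltw : size w < #|T|.
  by rewrite -[(size w).+1]/(size (x :: w)) -(card_uniqP Uw) max_card.
have hw : has (has_walk x (last x w)) (iota 0 #|T|).
  by apply/hasP; exists (size w); [rewrite mem_iota | apply/has_walkP; exists w].
have := nth_find 0 hw; rewrite nth_iota //.
by move: hw; rewrite has_find size_iota.
Qed.

Lemma dist_min x y k : has_walk x y k -> dist x y <= k.
Proof.
move=> wk; have [ltk | lek] := ltnP k #|T|.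
  rewrite leqNgt; apply/negP => /(before_find 0).
  by rewrite nth_iota // add0n wk.
by apply: leq_trans lek; rewrite -[leqRHS](size_iota 0) find_size.
Qed.

End Graph.

Section PowerGraph.

Variable gT : finGroupType.

(* y is a power of x with positive exponent; as gT is finite, the exponents
   1, ..., #[x] already give all powers (see is_powerP). *)
Definition is_power (x y : gT) : bool := [exists m : 'I_#[x], y == x ^+ m.+1].

Lemma is_powerP x y :
  reflect (exists2 m, 0 < m & y = x ^+ m) (is_power x y).
Proof.
apply: (iffP existsP) => [[m /eqP->] | [[//|m] _ ->]]; first by exists m.+1.
have lt_m : m %% #[x] < #[x] by rewrite ltn_mod order_gt0.
by exists (Ordinal lt_m); rewrite /= !expgS expg_mod_order.
Qed.

Definition power_adj : rel gT :=
  fun x y => (x != y) && (is_power x y || is_power y x).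

Definition power_graph (G : {set gT}) : rel {x : gT | x \in G} :=
  fun u v => power_adj (val u) (val v).

(* Adjacency in power_graph G does not depend on G, so its subgraph induced on
   G^# is power_graph G^#. *)
Definition proper_power_graph (G : {set gT}) : rel {x : gT | x \in G^#} :=
  @power_graph G^#.

Lemma power_graph_sym G : symmetric (@power_graph G).
Proof. by move=> u v; rewrite /power_graph /power_adj eq_sym orbC. Qed.

Lemma power_graph_irr G : irreflexive (@power_graph G).
Proof. by move=> u; rewrite /power_graph /power_adj eqxx. Qed.

End PowerGraph.

Arguments power_graph {gT} G u v.
Arguments proper_power_graph {gT} G u v.

(* Main.v *)
(* Commuting elements of coprime orders are joined by a path of length 2 through
   their product, so everything is about chains of commuting elements of distinct
   prime orders.  An element y of prime order commutes with every permutation that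
   shifts cyclically some orbits of y of equal size; these shifts are the links of
   the chains.

   Upper bounds.  Two elements of prime order are linked through shifts a and a'
   which either commute (three steps) or fix four common points, on which a double
   transposition acts (four steps).  For the bound 11 the difficult elements are
   the products of three q-cycles with at most two fixed points: they are first
   linked to an element of order 3.  For the bound 8 every element of prime order
   with at most two fixed points has at least 3p + 2 orbits of size q <= p, which
   leaves room for a and a' to have disjoint supports.

   Lower bound.  For m = n - 1 or n - 2 odd, an m-cycle generates its centralizer in
   A_n and its nontrivial powers all have the same fixed points.  If two m-cycles
   have different fixed points, then none of their nontrivial powers commute,
   which excludes paths of length at most 5. *)
Require Import Defs.
From mathcomp Require Import all_boot all_fingroup all_solvable.
From mathcomp Require Import zify.

Set Implicit Arguments.
Unset Strict Implicit.
Unset Printing Implicit Defensive.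

(** * Walks in the proper power graph *)

Section Reach.

Variables (gT : finGroupType) (G : {group gT}).
Implicit Types (x y z : gT) (k : nat).

(** Walks live in [gT] with a membership condition instead of in the subtype of vertices, and [k] is
    only an upper bound, which absorbs coinciding vertices. *)
Definition reach k x y :=
  exists w : seq gT, [/\ size w <= k, all [in G^#%g] (x :: w),
    path (@power_adj gT) x w & last x w = y].

Lemma reach_refl x : x \in G^#%g -> reach 0 x x.
Proof. by move=> Gx; exists [::]; split; rewrite //= Gx. Qed.

Lemma reach_leq k l x y : k <= l -> reach k x y -> reach l x y.
Proof. by move=> lekl [w [sw Gw pw lw]]; exists w; split=> //; lia. Qed.

Lemma reach_trans k l x y z : reach k x y -> reach l y z -> reach (k + l) x z.
Proof.
move=> [w [sw Gw pw lw]] [w' [sw' Gw' pw' lw']]; exists (w ++ w'); split.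
- by rewrite size_cat leq_add.
- by move: Gw Gw' => /= /andP[-> Gw] /andP[_ Gw']; rewrite all_cat Gw.
- by rewrite cat_path pw lw.
- by rewrite last_cat lw.
Qed.

Lemma is_power_cycle x y : is_power x y = (y \in <[x]>%g).
Proof.
apply/is_powerP/cycleP => [[m _ ->]|[[|i] ->]]; first by exists m.
  by exists #[x]%g; rewrite ?order_gt0 ?expg_order.
by exists i.+1.
Qed.

Lemma power_adjC : symmetric (@power_adj gT).
Proof. by move=> x y; rewrite /power_adj eq_sym orbC. Qed.

Lemma reach_sym k x y : reach k x y -> reach k y x.
Proof.
move=> [w [sw Gw pw lw]]; exists (rev (belast x w)); split.
- by rewrite size_rev size_belast.
- apply/allP => z; rewrite inE mem_rev => z_in; move/allP: Gw; apply.
  case/orP: z_in => [/eqP->|/mem_belast //]; rewrite -lw; exact: mem_last.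
- rewrite -lw rev_path; apply: sub_path pw => a b /=; by rewrite power_adjC.
- by rewrite -lw; case: w {sw Gw pw lw} => //= a w; rewrite rev_cons last_rcons.
Qed.

Lemma reach_power x y : x \in G^#%g -> y != 1%g -> y \in <[x]>%g -> reach 1 x y.
Proof.
move=> Gx y1 yx; have [<-|xy] := eqVneq x y.
  exact/(reach_leq _ (reach_refl Gx)).
have Gy : y \in G^#%g.
  by case/setD1P: Gx => _; rewrite !inE y1 -cycle_subG => /subsetP; apply.
by exists [:: y]; split; rewrite //= ?Gx ?Gy // /power_adj xy is_power_cycle yx.
Qed.

(** Coprimality makes [<[y * z]>] the product of [<[y]>] and [<[z]>], so it contains both [y] and
    [z]. *)
Lemma reach_coprime y z : y \in G^#%g -> z \in G^#%g -> commute y z ->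
  coprime #[y]%g #[z]%g -> reach 2 y z.
Proof.
move=> Gy Gz cyz co; have [/setD1P[y1 yG] /setD1P[z1 zG]] := (Gy, Gz).
have cyc := cycleM cyz co.
have yc : y \in <[y * z]>%g.
  by have := mem_mulg (cycle_id y) (group1 <[z]>); rewrite mulg1 cyc.
have zc : z \in <[y * z]>%g.
  by have := mem_mulg (group1 <[y]>) (cycle_id z); rewrite mul1g cyc.
have Gyz : (y * z \in G^#)%g.
  rewrite !inE groupM // andbT; apply: contraNneq y1 => yz1.
  by move: yc; rewrite yz1 cycle1 => /set1P/eqP.
rewrite -[2]/(1 + 1); apply: (reach_trans (y := (y * z)%g)).
  exact/reach_sym/reach_power.
exact: reach_power.
Qed.

Lemma diam_leq k : (forall x y, x \in G^#%g -> y \in G^#%g -> reach k x y) ->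
  diam (proper_power_graph G) <= k.
Proof.
move=> Rk; apply/bigmax_leqP => u _; apply/bigmax_leqP => v _.
have [w [sw Gw pw lw]] := Rk _ _ (valP u) (valP v).
apply: (leq_trans _ sw); apply: dist_min; apply/has_walkP.
suff [w' [sw' pw' lw']] : exists w' : seq {x : gT | x \in G^#%g},
    [/\ size w' = size w, path (proper_power_graph G) u w' & val (last u w') = last (val u) w].
  by exists w'; split=> //; apply: val_inj; rewrite lw'.
elim: w u {sw lw} Gw pw => [|a w IHw] u; first by exists [::].
move=> /= /and3P[Gu Ga Gw] /andP[ua pw].
have [] := IHw (Sub a Ga); rewrite /= ?Ga // => w' [sw' pw' lw'].
by exists (Sub a Ga :: w'); split=> //=; [rewrite sw' | rewrite pw' andbT].
Qed.

(* Within two steps of x one only meets elements having a nontrivial power of x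
   as a power; a path of length at most 5 from x to x' has two equal or adjacent
   vertices, one within two steps of each end. *)
Lemma diam_gt5 x x' : connected_graph (proper_power_graph G) ->
  x \in G^#%g -> x' \in G^#%g ->
  ('C_G[x] \subset <[x]>)%g -> ('C_G[x'] \subset <[x']>)%g ->
  (forall y y', y \in <[x]>^#%g -> y' \in <[x']>^#%g -> ~ commute y y') ->
  6 <= diam (proper_power_graph G).
Proof.
move=> conn Gx Gx' Cx Cx' ncomm.
pose u : {x : gT | x \in G^#%g} := Sub x Gx; pose v : {x : gT | x \in G^#%g} := Sub x' Gx'.
suff : 5 < dist (proper_power_graph G) u v.
  move=> d; apply: leq_trans d _.
  by apply: leq_trans (leq_bigmax u); apply: leq_trans (leq_bigmax v).
rewrite ltnNge; apply/negP => d5.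
have /has_walkP[w [sw pw lw]] := dist_walk (conn u v).
(* [adj] allows equality, so that a walk with fewer than five edges can be padded to five. *)
pose adj (a b : {x : gT | x \in G^#%g}) := (a == b) || proper_power_graph G a b.
have adjE a b : adj a b ->
    (val b \in <[val a]>%g) \/ (val a \in <[val b]>%g).
  rewrite /adj /proper_power_graph /power_graph /power_adj !is_power_cycle.
  by case/orP=> [/eqP->|/andP[_ /orP]] //; left; apply: cycle_id.
have adjC a b : adj a b -> adj b a.
  by rewrite /adj eq_sym /proper_power_graph power_graph_sym.
pose near g (a : {x : gT | x \in G^#%g}) := exists2 y, y \in <[g]>^#%g & y \in <[val a]>%g.
have near2 (g : gT) (Gg : g \in G^#%g) a b : ('C_G[g] \subset <[g]>)%g -> adj (Sub g Gg) a ->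
    adj a b -> near g b.
  move=> Cg /adjE ga /adjE ab.
  (* If [g] is a power of [a], then [a] centralizes [g] and so lies in [<[g]>]. *)
  have {ga} ag : val a \in <[g]>^#%g.
    rewrite !inE; have /setD1P[-> aG] := valP a.
    case: ga => //= ga; apply: (subsetP Cg); rewrite inE aG; apply/cent1P.
    by have /cycleP[i ->] := ga; apply: commuteX.
  case: ab => [ba | ab]; last by exists (val a).
  exists (val b); last exact: cycle_id.
  have /setD1P[b1 _] := valP b; rewrite !inE b1.
  by case/setD1P: ag => _; rewrite -cycle_subG => /subsetP; apply.
have contra a b : near x a -> near x' b -> adj a b -> False.
  move=> [y yx ya] [y' yx' yb] /adjE ab; apply: (ncomm y y') => //.
  suff [c [yc yc']] : exists c : gT, y \in <[c]>%g /\ y' \in <[c]>%g.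
    by have /cycleP[i ->] := yc; have /cycleP[j ->] := yc'; apply/commuteX/commute_sym/commuteX.
  case: ab => ab; [exists (val a)|exists (val b)]; split=> //.
    by rewrite -cycle_subG in ab; apply: subsetP yb.
  by rewrite -cycle_subG in ab; apply: subsetP ya.
have adjj a : adj a a by rewrite /adj eqxx.
have key a b c d : adj u a -> adj a b -> adj b c -> adj c d -> adj d v -> False.
  move=> ua ab bc cd dv; apply: (contra b c) => //; first exact: (near2 x Gx a).
  by apply: (near2 x' Gx' d) => //; apply: adjC.
have e_adj a b : proper_power_graph G a b -> adj a b by rewrite /adj orbC => ->.
case: w sw pw lw => [|a1 [|a2 [|a3 [|a4 [|a5 [|a6 w]]]]]] /= sw;
  last by move: d5; rewrite -sw.
- by move=> _ uv; apply: (key u u u u); rewrite -?uv.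
- move=> /andP[p1 _] uv; apply: (key u u u u) => //; rewrite -?uv; exact: e_adj.
- move=> /and3P[p1 p2 _] uv; apply: (key a1 a1 a1 a1) => //; rewrite -?uv; exact: e_adj.
- move=> /and4P[p1 p2 p3 _] uv; apply: (key a1 a2 a2 a2) => //; rewrite -?uv; exact: e_adj.
- move=> /and5P[p1 p2 p3 p4 _] uv.
  by apply: (key a1 a2 a3 a3) => //; rewrite -?uv //; apply: e_adj.
- move=> /and5P[p1 p2 p3 p4 /andP[p5 _]] uv.
  by apply: (key a1 a2 a3 a4) => //; rewrite -?uv //; apply: e_adj.
Qed.

End Reach.

(** * Permutations that shift orbits cyclically *)

Section Blocks.

Variable T : finType.
Implicit Types (y a : {perm T}) (O : {set {set T}}) (W : {set T}) (s : nat).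

Lemma subset_of_card (aT : finType) (A : {set aT}) k : k <= #|A| ->
  exists2 B : {set aT}, B \subset A & #|B| = k.
Proof.
case/card_geqP => s [Us sk sA]; exists [set t in s].
  by apply/subsetP => t; rewrite inE => /sA.
by rewrite cardsE (card_uniqP Us).
Qed.

Definition orbs y s : {set {set T}} := [set A in porbits y | #|A| == s].

Lemma orbsP y s A : reflect (exists2 t, A = porbit y t & #|A| = s) (A \in orbs y s).
Proof.
rewrite inE; apply: (iffP andP) => [[/imsetP[t _ ->] /eqP] | [t -> ->]]; first by exists t.
by rewrite eqxx imset_f.
Qed.

Lemma expg_porbit_fix y t i : ((y ^+ i)%g t == t) = (#|porbit y t| %| i).
Proof.
set k := #|_|; have k_gt0 : 0 < k by rewrite lt0n card_porbit_neq0.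
have yk j : (y ^+ (j * k))%g t = t.
  elim: j => [|j IHj]; first by rewrite perm1.
  by rewrite mulSn expgD permM [(y ^+ k)%g t]permX iter_porbit.
have lt_ik : i %% k < k by rewrite ltn_pmod.
rewrite {1}(divn_eq i k) expgD permM yk permX.
have -> : iter (i %% k) y t = nth t (traject y t k) (i %% k) by rewrite nth_traject.
have e0 : nth t (traject y t k) 0 = t by rewrite nth_traject.
rewrite -[X in _ == X]e0.
by rewrite nth_uniq ?size_traject ?uniq_traject_porbit.
Qed.

(** Both equalities say that the common orbit size divides the difference of [i] and [j]. This makes
    the orbit shift well defined. *)
Lemma expg_porbit_eq y t t' i j : #|porbit y t| = #|porbit y t'| ->
  (y ^+ i)%g t = (y ^+ j)%g t -> (y ^+ i)%g t' = (y ^+ j)%g t'.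
Proof.
wlog leij : i j / i <= j => [IH e h|].
  have [|/ltnW] := leqP i j => le; first exact: IH h.
  by apply/esym/IH.
move=> e; rewrite -(subnK leij) addnC !expgD !permM => h.
have h' x : (y ^+ (j - i))%g ((y ^+ i)%g x) = (y ^+ i)%g x <-> #|porbit y x| %| j - i.
  by have := expg_porbit_fix y ((y ^+ i)%g x) (j - i); rewrite porbit_perm => <-; split=> /eqP.
by apply/esym/h'; rewrite -e; apply/h'.
Qed.

Lemma in_cover_orbs y s O t : O \subset orbs y s ->
  (t \in cover O) = (porbit y t \in O).
Proof.
move=> /subsetP sO; apply/bigcupP/idP => [[A OA At]|Ot]; last first.
  by exists (porbit y t); rewrite // porbit_id.
have /orbsP[u defA _] := sO _ OA; move: At OA; rewrite defA => At.
have /eqP-> : porbit y t == porbit y u by rewrite eq_porbit_mem.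
by rewrite -defA.
Qed.

(* Cyclic shift of l orbits of the same size: choose a base point in each and
   send y^i c_j to y^i c_(j+1). *)
Lemma orbit_shift y s O l : O \subset orbs y s -> #|O| = l ->
  exists z : {perm T}, [/\ commute y z, perm_on (cover O) z, (z ^+ l = 1)%g,
    (forall t i, t \in cover O -> 0 < i < l -> (z ^+ i)%g t != t)
  & (forall t t', t \in cover O -> t' \in cover O ->
       exists i, porbit y ((z ^+ i)%g t) = porbit y t')].
Proof.
move=> sO cO; have [t0 _|T0] := pickP (@predT T); last first.
  exists 1%g; split.
  - exact: commute1.
  - exact: perm_on1.
  - by rewrite expg1n.
  - by move=> t; have := T0 t.
  - by move=> t; have := T0 t.
case: l cO => [/eqP|l cO].
  rewrite cards_eq0 => /eqP O0; exists 1%g.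
  have cov0 t : t \in cover O = false by rewrite O0 /cover big_set0 inE.
  split=> //; first exact: commute1; first exact: perm_on1.
    by move=> t i; rewrite cov0.
  by move=> t t'; rewrite cov0.
pose c (j : 'I_l.+1) := odflt t0 [pick t in enum_val (cast_ord (esym cO) j)].
have cE j : porbit y (c j) = enum_val (cast_ord (esym cO) j).
  rewrite /c; have /(subsetP sO) := enum_valP (cast_ord (esym cO) j).
  case/orbsP=> t -> _; case: pickP => [u|/(_ t)]; last by rewrite porbit_id.
  by rewrite -eq_porbit_mem => /eqP.
have c_inj i j : porbit y (c i) = porbit y (c j) -> i = j.
  by rewrite !cE => /enum_val_inj/cast_ord_inj.
have cs j : #|porbit y (c j)| = s.
  by have /(subsetP sO)/orbsP[t _] := enum_valP (cast_ord (esym cO) j); rewrite cE.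
have cP t : reflect (exists i j, t = (y ^+ i)%g (c j)) (t \in cover O).
  rewrite (in_cover_orbs _ sO); apply: (iffP idP) => [Ot|[i [j ->]]]; last first.
    by rewrite porbit_perm cE enum_valP.
  pose j := cast_ord cO (enum_rank_in Ot (porbit y t)).
  have : t \in porbit y (c j).
    by rewrite cE cast_ord_comp cast_ord_id enum_rankK_in // porbit_id.
  by case/porbitP=> i ->; exists i, j.
(* [f] picks one representation [y^i c_j] of [t]; by [fE] any other gives the same value, as all
   orbits in [O] have size [s]. *)
pose f t := if [pick ij : 'I_#[y]%g * 'I_l.+1 | t == (y ^+ ij.1)%g (c ij.2)]
  is Some ij then (y ^+ ij.1)%g (c (ordS ij.2)) else t.
have fE i j : f ((y ^+ i)%g (c j)) = (y ^+ i)%g (c (ordS j)).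
  rewrite /f; case: pickP => [[i' j'] /= /eqP e|].
    have ej : j = j' by apply: c_inj; rewrite -(porbit_perm y i) e porbit_perm.
    by subst j'; apply/esym/(expg_porbit_eq _ e); rewrite !cs.
  have lt_i : i %% #[y]%g < #[y]%g by rewrite ltn_mod order_gt0.
  by move/(_ (Ordinal lt_i, j)); rewrite /= expg_mod_order eqxx.
have fO t : t \notin cover O -> f t = t.
  rewrite /f; case: pickP => [[i j] /= /eqP->|//].
  by case/cP; exists i, j.
have f_inj : injective f.
  move=> t t'.
  have [/cP[i [j ->]] | /[dup] tO /fO ->] := boolP (t \in cover O);
  have [/cP[i' [j' ->]] | /[dup] tO' /fO ->] := boolP (t' \in cover O) => //.
  - rewrite !fE => e; have ej : j = j'.
      apply/(@ordS_inj l.+1)/c_inj.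
      by rewrite -(porbit_perm y i) e porbit_perm.
    by subst j'; apply: expg_porbit_eq e; rewrite !cs.
  - by rewrite fE => e; case/cP: tO'; rewrite -e; do 2!eexists.
  - by rewrite fE => e; case/cP: tO; rewrite e; do 2!eexists.
pose z := perm f_inj.
have zE k i j : (z ^+ k)%g ((y ^+ i)%g (c j)) = (y ^+ i)%g (c (iter k (@ordS _) j)).
  elim: k => [|k IHk]; first by rewrite expg0 perm1.
  by rewrite expgSr permM IHk permE fE.
have ordE k (j : 'I_l.+1) : iter k (@ordS _) j = (j + k) %% l.+1 :> nat.
  elim: k => [|k IHk] /=; first by rewrite addn0 modn_small.
  by rewrite IHk -addn1 modnDml addn1 addnS.
have zO t : t \notin cover O -> z t = t by move=> /fO; rewrite permE.
exists z; split.
- apply/permP=> t; rewrite !permM.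
  have [/cP[i [j ->]] | tO] := boolP (t \in cover O).
    have := zE 1 i.+1 j; rewrite expg1 expgSr permM => ->.
    by have := zE 1 i j; rewrite expg1 => ->; rewrite /= permM.
  have ytO : y t \notin cover O.
    rewrite (in_cover_orbs _ sO) in tO; rewrite (in_cover_orbs _ sO).
    by have := porbit_perm y 1 t; rewrite expg1 => ->.
  by rewrite !zO.
- by apply/subsetP => t; apply: contraR => /zO/eqP.
- apply/permP=> t; rewrite perm1.
  have [/cP[i [j ->]] | tO] := boolP (t \in cover O).
    by rewrite zE; congr (_ (c _)); apply: ord_inj; rewrite ordE modnDr modn_small.
  by elim: l.+1 => [|k IHk]; rewrite ?perm1 // expgS permM zO.
- move=> t k /cP[i [j ->]] /andP[k0 kl]; rewrite zE; apply/eqP => e.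
  have /(congr1 (@nat_of_ord _)) : iter k (@ordS _) j = j.
    by apply: c_inj; rewrite -(porbit_perm y i) e porbit_perm.
  rewrite ordE => /eqP; rewrite -{2}(modn_small (ltn_ord j)) -{2}[val j]addn0.
  by rewrite eqn_modDl mod0n modn_small // => /eqP k_0; rewrite k_0 in k0.
move=> _ _ /cP[i [j ->]] /cP[i' [j' ->]].
(* Rotation by [j' - j] modulo [l.+1], written so that the subtraction does not truncate. *)
exists (j' + (l.+1 - j)); rewrite zE !porbit_perm; congr (porbit y (c _)).
apply: ord_inj; rewrite ordE addnCA subnKC ?modnDr ?modn_small //.
by apply: ltnW.
Qed.

(* For odd s, exchanging two orbits of size s is an odd permutation; an even
   involution is the square of a shift of four orbits. *)
Definition blk r := if r == 2 then 4 else r.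

Lemma odd_permX a i : odd_perm (a ^+ i)%g = odd i && odd_perm a.
Proof.
elim: i => [|i IHi]; first by rewrite odd_perm1.
by rewrite expgS odd_permM IHi /=; case: odd; case: odd_perm.
Qed.

Lemma odd_order_even_perm a : odd #[a]%g -> odd_perm a = false.
Proof.
move=> oa; have := congr1 (@odd_perm T) (expg_order a).
by rewrite odd_permX oa odd_perm1.
Qed.

Lemma perm_onX W a i : perm_on W a -> perm_on W (a ^+ i)%g.
Proof.
move=> aW; elim: i => [|i IHi]; first exact: perm_on1.
by rewrite expgS perm_onM.
Qed.

(** For odd [r] the shift itself is even because its order is odd; for [r = 2] the square of a shift
    of four orbits is taken. *)
Lemma block_elt y s O r : prime r -> O \subset orbs y s -> #|O| = blk r -> 0 < s ->
  exists a, [/\ (a \in 'Alt_T)%g, #[a]%g = r, commute y a, perm_on (cover O) a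
    & {in cover O, forall t, a t != t}].
Proof.
move=> r_pr sO cO s_gt0; have [z [cz zO z1 zf _]] := orbit_shift sO cO.
have r1 := prime_gt1 r_pr.
have [t tO] : exists t, t \in cover O.
  have /card_gt0P[A OA] : 0 < #|O| by rewrite cO /blk; case: ifP; lia.
  have /orbsP[t defA _] := subsetP sO _ OA.
  by exists t; rewrite (in_cover_orbs _ sO) -defA.
pose m := blk r %/ r.
have m_gt0 : 0 < m < blk r.
  by rewrite /m /blk; case: eqP => [->//|_]; rewrite divnn (prime_gt0 r_pr).
have zmr : ((z ^+ m) ^+ r = 1)%g.
  by rewrite -expgM divnK ?z1 // /blk; case: eqP => // ->.
have zm1 : {in cover O, forall t, (z ^+ m)%g t != t} by move=> u uO; apply: zf.
have om : #[z ^+ m]%g = r.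
  have /(prime_nt_dvdP r_pr) -> // : (#[z ^+ m]%g %| r) by rewrite order_dvdn zmr.
  by rewrite order_eq1; apply: contra (zm1 _ tO) => /eqP->; rewrite perm1.
exists (z ^+ m)%g; split=> //; last exact: perm_onX; last exact: commuteX.
rewrite Alt_even; have [r2|r_odd] := even_prime r_pr.
  by rewrite odd_permX /m r2.
by rewrite odd_order_even_perm // om.
Qed.

Lemma block_avoid y s r W : prime r -> 0 < s ->
  blk r + #|[set porbit y t | t in W]| <= #|orbs y s| ->
  exists a, [/\ (a \in 'Alt_T)%g, #[a]%g = r, commute y a & perm_on (~: W) a].
Proof.
move=> r_pr s_gt0 le_r.
pose O1 := orbs y s :\: [set porbit y t | t in W].
have : blk r <= #|O1|.
  rewrite cardsD -(leq_add2r #|[set porbit y t | t in W]|) (leq_trans le_r) //.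
  by rewrite addnC -leq_subLR leq_sub2l // subset_leq_card // subsetIr.
case/subset_of_card => O sOO1 cO.
have sO : O \subset orbs y s by apply: subset_trans sOO1 _; apply: subsetDl.
have [a [aA ra ya aO _]] := block_elt r_pr sO cO s_gt0.
exists a; split=> //; apply: subset_trans aO _; apply/subsetP => t.
rewrite (in_cover_orbs _ sO) => /(subsetP sOO1); rewrite !inE => /andP[tW _].
by apply: contra tW => tW; apply: imset_f.
Qed.

Lemma block_avoid_card y s r W : prime r -> 0 < s -> blk r + #|W| <= #|orbs y s| ->
  exists a, [/\ (a \in 'Alt_T)%g, #[a]%g = r, commute y a & perm_on (~: W) a].
Proof.
move=> r_pr s_gt0 le_r; apply: block_avoid r_pr s_gt0 (leq_trans _ le_r).
by rewrite leq_add2l leq_imset_card.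
Qed.

End Blocks.

(** * Orbit counts for elements of prime order *)

Section PrimeOrder.

Variable T : finType.
Implicit Types (x y a : {perm T}) (W : {set T}).

(** Points are grouped by orbit; [s = 1] gives the number of fixed points. *)
Lemma orbs_cover_card y s : #|[set t | #|porbit y t| == s]| = s * #|orbs y s|.
Proof.
rewrite -sum1_card (partition_big (porbit y) [in orbs y s]) => [|t]; last first.
  by rewrite !inE => ->; rewrite imset_f.
rewrite mulnC -sum_nat_const; apply: eq_bigr => _ /orbsP[t -> ts].
rewrite sum1dep_card -ts; apply: eq_card => u; rewrite !inE eq_porbit_mem.
apply: andb_idl; rewrite -eq_porbit_mem => /eqP->; exact/eqP.
Qed.

Lemma card_orbs y q : prime q -> #[y]%g = q ->
  #|T| = #|orbs y 1| + q * #|orbs y q|.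
Proof.
move=> q_pr yq; have q1 := prime_gt1 q_pr.
rewrite -[#|orbs y 1|]mul1n -!orbs_cover_card -cardsUI.
rewrite [X in _ + #|pred_of_set X|](_ : _ = set0); last first.
  by apply/setP => t; rewrite !inE; case: eqP => //= ->; apply/negbTE; lia.
rewrite cards0 addn0 -[LHS]cardsT; apply: eq_card => t; rewrite !inE; apply/esym.
have : #|porbit y t| %| q by rewrite -yq -expg_porbit_fix expg_order perm1.
by case/primeP: q_pr => _ /[apply].
Qed.

Lemma orbs_prime_gt0 y q : prime q -> #[y]%g = q -> 0 < #|orbs y q|.
Proof.
move=> q_pr yq; rewrite lt0n; apply/eqP => k0.
have y1 : y = 1%g.
  apply/permP=> t; rewrite perm1; apply/eqP.
  have := expg_porbit_fix y t 1; rewrite expg1 => ->; rewrite dvdn1.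
  have : t \in [set t | #|porbit y t| == 1].
    suff -> : [set t | #|porbit y t| == 1] = setT by rewrite inE.
    apply/eqP; rewrite eqEcard subsetT cardsT orbs_cover_card.
    by rewrite (card_orbs q_pr yq) k0 muln0 addn0 mul1n /= leqnn.
  by rewrite inE.
by move: (prime_gt1 q_pr); rewrite -yq y1 order1.
Qed.

Lemma prime_dvd_fact r K : prime r -> r %| K`! -> r <= K.
Proof.
move=> r_pr; elim: K => [|K IHK]; first by rewrite dvdn1 => /eqP r1; move: r_pr; rewrite r1.
rewrite factS Euclid_dvdM // => /orP[/dvdn_leq -> //|/IHK]; lia.
Qed.

(* x permutes the orbits of y of each size, so x ^ K! preserves every orbit of y,
   on which it then agrees with a power of y. *)
Lemma order_dvd_fact y q x K : prime q -> #[y]%g = q -> commute x y ->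
  #|orbs y 1| <= K -> #|orbs y q| <= K -> #[x]%g %| K`! * q.
Proof.
move=> q_pr yq cxy K1 Kq; rewrite order_dvdn; apply/eqP/permP => t; rewrite perm1.
have [i ei] : exists i, (x ^+ K`!)%g t = (y ^+ i)%g t.
  apply/porbitP.
  have f_inj : injective (fun A : {set T} => x @: A) by apply/imset_inj/perm_inj.
  have fE u : x @: porbit y u = porbit y (x u).
    apply/setP => v; apply/imsetP/porbitP => [[_ /porbitP[i ->] ->]|[i ->]].
      by exists i; rewrite -!permM (commuteX i cxy).
    by exists ((y ^+ i)%g u); rewrite ?mem_porbit // -!permM (commuteX i cxy).
  have iterE k u : iter k (fun A : {set T} => x @: A) (porbit y u) = porbit y ((x ^+ k)%g u).
    by elim: k => [|k IHk] /=; rewrite ?perm1 // IHk fE expgSr permM.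
  (* [x] maps orbits of [y] to orbits of the same size, and there are at most [K] of each size. *)
  have le_ord : fingraph.order (fun A : {set T} => x @: A) (porbit y t) <= K.
    have : #|porbit y t| %| q by rewrite -yq -expg_porbit_fix expg_order perm1.
    have sub s : #|porbit y t| = s ->
        fingraph.order (fun A : {set T} => x @: A) (porbit y t) <= #|orbs y s|.
      move=> ts; apply: subset_leq_card; apply/subsetP => A.
      rewrite inE => /iter_findex <-; rewrite iterE; apply/orbsP.
      exists ((x ^+ findex (fun A : {set T} => x @: A) (porbit y t) A)%g t) => //.
      by rewrite -iterE; elim: findex => //= k <-; rewrite card_imset //; apply: perm_inj.
    by case/primeP: q_pr => _ /[apply] /orP[] /eqP/sub h; apply: leq_trans h _.
  have /dvdnP[m mE] : fingraph.order (fun A : {set T} => x @: A) (porbit y t) %| K`!.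
    by rewrite dvdn_fact // le_ord fingraph.order_gt0.
  rewrite -eq_porbit_mem -iterE mE; elim: m {mE} => [|m IHm] //.
  by rewrite mulSn iterD (eqP IHm) iter_order.
(* As [x] and [y] commute, the agreement at [t] passes to [j]-th powers; [j = q] gives the
   identity. *)
have com j : (x ^+ (K`! * j))%g t = (y ^+ (i * j))%g t.
  elim: j => [|j IHj]; first by rewrite !muln0.
  rewrite !mulnS expgD permM ei -permM.
  have -> : (y ^+ i * x ^+ (K`! * j) = x ^+ (K`! * j) * y ^+ i)%g.
    by apply/esym/commuteX/commute_sym/commuteX/commute_sym.
  by rewrite permM IHj -permM -expgD addnC.
by rewrite com mulnC expgM -yq expg_order expg1n perm1.
Qed.

(** If the first case fails, a prime [r <= K] dividing [#[x]] would give at most [K + K * K] points.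
    So [#[x]] is coprime to [K!], and [order_dvd_fact], applied to a power of [x] of prime order
    [q], leaves [#[x] = q]. *)
Lemma powers_dichotomy x K : x != 1%g -> K + K * K < #|T| ->
  (exists2 y, y \in <[x]>%g & exists q, [/\ prime q, #[y]%g = q &
     (K < #|orbs y 1|) || (K < #|orbs y q|)])
  \/ (exists q, [/\ prime q, #[x]%g = q, #|orbs x 1| <= K & #|orbs x q| <= K]).
Proof.
move=> x1 ltK.
have [hA|nA] := boolP [exists y in <[x]>%g, [&& prime #[y]%g &
     (K < #|orbs y 1|) || (K < #|orbs y #[y]%g|)]].
  left; have /exists_inP[y yx /andP[y_pr yK]] := hA.
  by exists y => //; exists #[y]%g.
right.
have few r : prime r -> r %| #[x]%g ->
    [/\ #|orbs (x ^+ (#[x]%g %/ r))%g 1| <= K, #|orbs (x ^+ (#[x]%g %/ r))%g r| <= K,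
        #[x ^+ (#[x]%g %/ r)]%g = r & K < r].
  move=> r_pr rx; set y := (x ^+ _)%g.
  have yr : #[y]%g = r.
    rewrite orderXdiv; last by rewrite dvdn_div.
    by rewrite -{1}(divnK rx) mulKn // divn_gt0 ?prime_gt0 // dvdn_leq ?order_gt0.
  move: nA; rewrite negb_exists_in => /forall_inP/(_ y (mem_cycle _ _)).
  rewrite yr r_pr /= negb_or -!leqNgt => /andP[f k]; split=> //.
  rewrite ltnNge; apply/negP => rK; move: ltK; rewrite (card_orbs r_pr yr).
  by rewrite ltnNge leq_add // leq_mul.
have x_gt1 : 1 < #[x]%g by rewrite order_gt1.
pose q := pdiv #[x]%g; have q_pr : prime q by apply: pdiv_prime.
have [f k yq _] := few q q_pr (pdiv_dvd _).
have xq : #[x]%g = q.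
  apply/eqP; rewrite eqn_dvd pdiv_dvd andbT.
  rewrite -(@Gauss_dvdr _ K`!); last first.
    rewrite /coprime; apply/negPn/negP => d1.
    have d_gt1 : 1 < gcdn #[x]%g K`! by rewrite ltn_neqAle eq_sym d1 gcdn_gt0 order_gt0.
    have := pdiv_dvd (gcdn #[x]%g K`!); rewrite dvdn_gcd => /andP[rx rK].
    have r_pr := pdiv_prime d_gt1.
    have [_ _ _] := few _ r_pr rx; rewrite ltnNge => /negP; apply.
    exact: prime_dvd_fact.
  apply: (order_dvd_fact q_pr yq) => //; exact/commuteX.
exists q; split=> //; first by move: f; rewrite xq divnn prime_gt0.
by move: k; rewrite xq divnn prime_gt0.
Qed.

End PrimeOrder.

(** * Lower bound: centralizers of long cycles *)

Section LongCycle.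

Variable T : finType.
Implicit Types (x y u v : {perm T}) (F W : {set T}).

(** On at most two points the only nontrivial permutation is a transposition, which is odd. *)
Lemma even_perm_on_le2 F v : ~~ odd_perm v -> perm_on F v -> #|F| <= 2 -> v = 1%g.
Proof.
move=> ev Fv F2; apply/permP=> t; rewrite perm1; apply/eqP; apply: contraR ev => vt.
suff -> : v = tperm t (v t) by rewrite odd_tperm eq_sym.
have tF : t \in F by apply: contraR vt => /(out_perm Fv)/eqP.
have FE : F = [set t; v t].
  apply/esym/eqP; rewrite eqEcard cards2 eq_sym vt F2 andbT.
  by apply/subsetP => s /set2P[] ->; rewrite ?(perm_closed _ Fv).
apply/permP => s; case: tpermP => [->//|->|/eqP st /eqP svt]; last first.
  by apply: (out_perm Fv); rewrite FE !inE negb_or st svt.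
have : v (v t) \in F by rewrite !(perm_closed _ Fv).
by rewrite FE => /set2P[//|/perm_inj/eqP]; rewrite (negPf vt).
Qed.

(** The cycles of length [#|W|] with support [W], in the form that [orbit_shift] provides. *)
Definition is_long_cycle W x :=
  [/\ perm_on W x, (x ^+ #|W| = 1)%g, {in W, forall t, x t != t}
    & {in W &, forall t t', exists i, (x ^+ i)%g t = t'}].

(** Shift the points of [W], seen as orbits of the identity. *)
Lemma long_cycle_exists W : 1 < #|W| -> exists x, is_long_cycle W x.
Proof.
move=> W1; pose O := [set [set t] | t in W].
have p1 t : porbit (1 : {perm T})%g t = [set t].
  apply/setP => s; rewrite inE; apply/porbitP/eqP => [[i ->]|->].
    by rewrite expg1n perm1.
  by exists 0; rewrite perm1.
have sO : O \subset orbs (1 : {perm T})%g 1.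
  by apply/subsetP=> _ /imsetP[t _ ->]; apply/orbsP; exists t; rewrite ?p1 ?cards1.
have cO : #|O| = #|W| by apply/card_imset/set1_inj.
have covO : cover O = W.
  apply/setP => t; rewrite (in_cover_orbs _ sO) p1.
  by rewrite mem_imset //; apply: set1_inj.
have [z [_ zW z1 zf ztr]] := orbit_shift sO cO; rewrite covO in zW zf ztr.
exists z; split=> // [t tW|t t' tW t'W]; first by have := zf t 1 tW; rewrite expg1; apply.
by have [i] := ztr t t' tW t'W; rewrite !p1 => /set1_inj; exists i.
Qed.

(** [u] agrees with some [x ^ i] at one point of [W], so [u * x ^- i] commutes with [x] and fixes
    all of [W]. It is even and moves at most two points, hence trivial. *)
Lemma long_cycle_cent W x u : is_long_cycle W x -> 0 < #|W| -> #|~: W| <= 2 -> odd #|W| ->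
  ~~ odd_perm u -> commute x u -> u \in <[x]>%g.
Proof.
move=> [xW x1 xf xtr] W_gt0 F2 W_odd eu cxu.
have [t tW] := card_gt0P W_gt0.
have utW : u t \in W.
  apply: contraR (xf t tW) => /(out_perm xW).
  by rewrite -permM -cxu permM => /perm_inj/eqP.
have [i ei] := xtr _ _ tW utW.
pose v := (u * x ^- i)%g.
have cxv : commute x v by apply: commuteM => //; apply/commuteV/commuteX.
have v1 : v = 1%g.
  apply: (@even_perm_on_le2 (~: W)) => //.
    rewrite odd_permM odd_permV odd_permX (negPf eu) odd_order_even_perm ?andbF //.
    by apply: dvdn_odd W_odd; rewrite order_dvdn x1.
  apply/subsetP => s; rewrite !inE; apply: contra => sW; apply/eqP.
  have [j <-] := xtr _ _ tW sW.
  rewrite -permM -(commuteX j (commute_sym cxv)) permM; congr (_ _).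
  by rewrite /v permM -ei permK.
by move/eqP: v1; rewrite -eq_mulgV1 => /eqP->; apply: mem_cycle.
Qed.

(** A power of [x] that fixes one point of [W] fixes its images under [x], which fill [W]. *)
Lemma long_cycle_power W x y t : is_long_cycle W x -> y \in <[x]>^#%g ->
  (y t == t) = (t \notin W).
Proof.
move=> [xW x1 xf xtr] /setD1P[y1 /cycleP[i yE]].
have yW : perm_on W y by rewrite yE perm_onX.
apply/eqP/idP => [yt|]; last exact: out_perm yW.
apply: contra y1 => tW; apply/eqP/permP => s; rewrite perm1.
have [sW|] := boolP (s \in W); last exact: out_perm yW.
have [j <-] := xtr _ _ tW sW.
by rewrite -permM yE -expgD addnC expgD permM -yE yt.
Qed.

(** If they commuted, [y'] would preserve the fixed points of [y], at most two in number, and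
    [y' ^+ 2] would fix them. But [y' ^+ 2] is nontrivial, [y'] having odd order, so it fixes
    exactly the complement of [W']. *)
Lemma long_cycle_ncomm W W' x x' y y' : is_long_cycle W x -> is_long_cycle W' x' ->
  odd #|W'| -> #|~: W| <= 2 -> #|W| = #|W'| -> W != W' ->
  y \in <[x]>^#%g -> y' \in <[x']>^#%g -> ~ commute y y'.
Proof.
move=> cx cx' W_odd F2 eW neW yx y'x' cyy'.
have fix_y := fun t => long_cycle_power t cx yx.
have y'W t : (y' t \in W) = (t \in W).
  apply: negb_inj; rewrite -!fix_y -permM -cyy' permM.
  by rewrite (inj_eq perm_inj).
have y'2 : (y' ^+ 2)%g \in <[x']>^#%g.
  move: y'x'; rewrite !inE => /andP[y'1 y'x']; rewrite groupX // andbT.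
  apply: contra y'1 => y'2; rewrite -order_eq1.
  have odd_y' : odd #[y']%g.
    have [_ x1 _ _] := cx'; apply: dvdn_odd W_odd; rewrite order_dvdn.
    by have /cycleP[i ->] := y'x'; rewrite -expgM mulnC expgM x1 expg1n.
  have : #[y']%g <= 2 by apply: dvdn_leq => //; rewrite order_dvdn.
  by move: odd_y'; case: #[y']%g (order_gt0 y') => [|[|[|]]].
have fix_y2 := fun t => long_cycle_power t cx' y'2.
case/negP: neW; rewrite eq_sym eqEcard eW leqnn andbT.
apply/subsetP => t; apply: contraLR => tW; rewrite -fix_y2.
rewrite expgS expg1 permM; have [e|y't] := eqVneq (y' t) t; first by rewrite !e.
have FE : ~: W = [set t; y' t].
  apply/esym/eqP; rewrite eqEcard cards2 eq_sym y't F2 andbT.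
  by apply/subsetP => s /set2P[] ->; rewrite !inE ?y'W.
have : y' (y' t) \in ~: W by rewrite !inE !y'W.
by rewrite FE => /set2P[->//|/perm_inj/eqP]; rewrite (negPf y't).
Qed.

Lemma diam_Alt_gt5 : 7 < #|T| ->
  connected_graph (proper_power_graph ('Alt_T)%g) ->
  6 <= diam (proper_power_graph ('Alt_T)%g).
Proof.
(* The number [f] of fixed points is chosen to make the cycle length odd. *)
move=> T7 conn; pose f := if odd #|T| then 2 else 1.
have f2 : 0 < f <= 2 by rewrite /f; case: odd.
have oT : odd (#|T| - f).
  by rewrite oddB; [rewrite /f; case: (odd #|T|) | lia].
have [|F _ cF] := @subset_of_card T setT f; first by rewrite cardsT; lia.
have cF' : #|~: F| = #|T| - f by rewrite cardsCs setCK cF.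
have [|F' sF' cF''] := @subset_of_card T (~: F) f; first by rewrite cF'; lia.
have cW : #|~: F'| = #|T| - f by rewrite cardsCs setCK cF''.
have [|x cx] := @long_cycle_exists (~: F); first by rewrite cF'; lia.
have [|x' cx'] := @long_cycle_exists (~: F'); first by rewrite cW; lia.
have inA W z : is_long_cycle W z -> #|W| = #|T| - f -> z \in ('Alt_T)^#%g.
  move=> [zW z1 zf _] Wf; apply/setD1P; split; last first.
    by rewrite Alt_even odd_order_even_perm //; apply: dvdn_odd oT; rewrite -Wf order_dvdn z1.
  have /card_gt0P[t tW] : 0 < #|W| by rewrite Wf; lia.
  by apply: contra (zf t tW) => /eqP->; rewrite perm1.
have cent W z : is_long_cycle W z -> #|W| = #|T| - f -> ('C_('Alt_T)[z] \subset <[z]>)%g.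
  move=> cz Wf; apply/subsetP=> u /setIP[]; rewrite Alt_even => eu /cent1P cu.
  apply: (long_cycle_cent cz); rewrite ?Wf //; first lia.
  by rewrite cardsCs setCK Wf subKn; lia.
apply: (@diam_gt5 _ 'Alt_T%G x x') => //; try by [apply: inA cx _|apply: inA cx' _|apply: cent cx _|apply: cent cx' _].
move=> y y'; apply: (long_cycle_ncomm cx cx'); rewrite ?setCK ?cW ?cF ?cF' //; first lia.
apply: contraTneq sF' => /setC_inj <-; apply/negP => /setIidPl.
by rewrite setICr => /esym F0; move: cF; rewrite F0 cards0; lia.
Qed.

End LongCycle.

(** * Links between elements of prime order *)

Section Reachable.

Variable T : finType.
Implicit Types (x y z a : {perm T}) (W : {set T}).
Local Notation reachA := (reach ('Alt_T)%G).

Definition prime_elt y q := [/\ prime q, #[y]%g = q & y \in ('Alt_T)%g].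

Lemma prime_elt_neq1 y q : prime_elt y q -> y \in ('Alt_T)^#%g.
Proof.
by move=> [q_pr yq yA]; apply/setD1P; split; rewrite // -order_gt1 yq prime_gt1.
Qed.

Lemma reach_prime y z q r : prime_elt y q -> prime_elt z r -> q != r ->
  commute y z -> reachA 2 y z.
Proof.
move=> yq zr qr cyz; apply: reach_coprime; rewrite ?(prime_elt_neq1 yq) ?(prime_elt_neq1 zr) //.
have [[q_pr -> _] [r_pr -> _]] := (yq, zr).
by rewrite prime_coprime // dvdn_prime2.
Qed.

Lemma disjoint_commute W W' a b : perm_on (~: W) a -> perm_on W' b -> W' \subset W ->
  commute a b.
Proof.
by move=> aW bW sW; apply: (perm_onC aW bW); rewrite disjoint_sym disjoints_subset setCK.
Qed.

Lemma reach3 y a b z q r r' q' : prime_elt y q -> prime_elt a r -> prime_elt b r' ->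
  prime_elt z q' -> q != r -> r != r' -> r' != q' ->
  commute y a -> commute a b -> commute b z -> reachA 6 y z.
Proof.
move=> yq ar br' zq' qr rr' r'q' ya ab bz.
apply: (@reach_trans _ _ 2 4 _ a); first exact: reach_prime yq ar _ _.
apply: (@reach_trans _ _ 2 2 _ b); first exact: reach_prime ar br' _ _.
exact: reach_prime br' zq' _ _.
Qed.

Lemma small_elt r W : prime r -> blk r <= #|W| ->
  exists2 c, prime_elt c r & perm_on W c.
Proof.
move=> r_pr rW.
have one : #|orbs (1 : {perm T})%g 1| = #|T|.
  have := orbs_cover_card (1 : {perm T})%g 1; rewrite mul1n => <-.
  rewrite -cardsT; apply: eq_card => t; rewrite !inE -dvdn1 -expg_porbit_fix.
  by rewrite expg1 perm1 eqxx.
have [||c [cA cr _ cW]] := @block_avoid_card T 1%g 1 r (~: W) r_pr.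
- by [].
- by rewrite one -(cardsC W) leq_add2r.
by exists c; rewrite ?setCK in cW *.
Qed.

Lemma card_cover_orbs y s (O : {set {set T}}) : O \subset orbs y s -> #|cover O| <= #|O| * s.
Proof.
move=> /subsetP sO; apply: leq_trans (leq_card_cover O).1 _.
by rewrite -sum_nat_const leq_sum // => A /sO/orbsP[t _ ->].
Qed.

(* Applied to W = T for y and then to the resulting W' for y', this leaves at least
   52/16 > 3 points fixed by both shifts. *)
Definition quarter y := forall W, 3 < #|W| ->
  exists a r W', [/\ prime_elt a r, r != 2 & r != #[y]%g] /\
    [/\ commute y a, W' \subset W, #|W| <= 4 * #|W'| & perm_on (~: W') a].

(** Every point of [W] lies outside some [S] in [L], so the sets [W :\: S] have average size at
    least [#|W| / size L]. *)
Lemma avoid_pigeonhole W (L : seq {set T}) : 0 < #|W| ->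
  {in W, forall t, has (fun S : {set T} => t \notin S) L} ->
  exists2 S, S \in L & #|W| <= size L * #|W :\: S|.
Proof.
move=> W_gt0 covL.
have sumL : #|W| <= \sum_(S <- L) #|W :\: S|.
  rewrite -sum1_card; under [leqRHS]eq_bigr do rewrite -sum1_card big_mkcond.
  rewrite exchange_big big_mkcond leq_sum // => t _; case: ifP => // tW.
  have /hasP[S SL tS] := covL t tW.
  by rewrite (big_rem S) //= inE tS tW.
have [/hasP[S SL hS]|nS] := boolP (has (fun S => #|W| <= size L * #|W :\: S|) L).
  by exists S.
have : size L * \sum_(S <- L) #|W :\: S| <= \sum_(S <- L) #|W|.-1.
  rewrite big_distrr big_seq [leqRHS]big_seq leq_sum // => S SL.
  by move/hasPn/(_ S SL): nS; rewrite -ltnNge => /=; lia.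
rewrite big_const_seq count_predT iter_addn_0 [leqRHS]mulnC.
have [L0|L_gt0] := posnP (size L).
  by move: sumL; rewrite (size0nil L0) big_nil; lia.
by rewrite leq_pmul2l //; lia.
Qed.

Lemma quarter_of_blocks y s r (L : seq {set {set T}}) : 0 < s -> prime r -> r != 2 ->
  r != #[y]%g -> 0 < size L <= 4 ->
  {in L, forall O : {set {set T}}, O \subset orbs y s /\ #|O| = blk r} ->
  (forall A, has (fun O : {set {set T}} => A \notin O) L) -> quarter y.
Proof.
move=> s_gt0 r_pr r2 ry sL LO covL W W_gt3.
have [||S /mapP[O OL ->] hS] := @avoid_pigeonhole W [seq cover Q | Q <- L].
- by lia.
- move=> t _; have /hasP[O OL tO] := covL (porbit y t); apply/hasP; exists (cover O).
    exact: map_f.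
  by have [sO _] := LO O OL; rewrite (in_cover_orbs _ sO).
have [sO cO] := LO O OL.
have [a [aA ar ya aO _]] := block_elt r_pr sO cO s_gt0.
exists a, r, (W :\: cover O); split; first by split.
split=> //; first exact: subsetDl.
  by apply: leq_trans hS _; rewrite size_map leq_mul2r; lia.
apply: subset_trans aO _; apply/subsetP => t tO; rewrite !inE negb_and negbK tO //.
Qed.

(** Two disjoint sets of five orbits, each with a shift of order 5. *)
Lemma quarter_ten y s : 0 < s -> #[y]%g != 5 -> 10 <= #|orbs y s| -> quarter y.
Proof.
move=> s_gt0 y5 /card_geqP[l [Ul sl lO]].
apply: (@quarter_of_blocks y s 5 [:: [set A in take 5 l]; [set A in drop 5 l]]) => //.
- by rewrite eq_sym.
- move=> O; rewrite !inE => /orP[] /eqP->.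
    rewrite cardsE (card_uniqP _) ?take_uniq ?size_take ?sl //; split=> //.
    by apply/subsetP => A; rewrite inE => /mem_take/lO.
  rewrite cardsE (card_uniqP _) ?drop_uniq ?size_drop ?sl //; split=> //.
  by apply/subsetP => A; rewrite inE => /mem_drop/lO.
move=> A /=; rewrite orbF !inE -negb_and; apply/negP => /andP[At Ad].
move: Ul; rewrite -(cat_take_drop 5 l) cat_uniq => /and3P[_ /hasPn/(_ A Ad)].
by rewrite /= At.
Qed.

(** No orbit belongs to all four triples chosen from four orbits. *)
Lemma quarter_four y s : 0 < s -> #[y]%g != 3 -> 4 <= #|orbs y s| -> quarter y.
Proof.
move=> s_gt0 y3 /subset_of_card[O sO O4].
apply: (@quarter_of_blocks y s 3 [seq O :\ A | A <- enum O]) => //.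
- by rewrite eq_sym.
- by rewrite size_map -cardE O4.
- move=> Q /mapP[A]; rewrite mem_enum => AO ->; split.
    by apply: subset_trans sO; apply: subsetDl.
  by move: (cardsD1 A O); rewrite AO O4 => -[].
move=> A; apply/hasP.
have [AO|AO] := boolP (A \in O).
  exists (O :\ A); last by rewrite !inE eqxx.
  by apply/mapP; exists A; rewrite ?mem_enum.
have /card_gt0P[B BO] : 0 < #|O| by rewrite O4.
exists (O :\ B); last by rewrite !inE (negPf AO) andbF.
by apply/mapP; exists B; rewrite ?mem_enum.
Qed.

Lemma fixed_cycle y : 3 <= #|orbs y 1| ->
  exists a W, [/\ prime_elt a 3, commute y a, perm_on W a & #|W| <= 3].
Proof.
case/subset_of_card=> O sO O3.
have [//||a [aA ar ya aO _]] := block_elt (r := 3) _ sO O3; first by [].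
exists a, (cover O); split=> //.
by have := card_cover_orbs sO; rewrite O3.
Qed.

(** A 3-cycle on fixed points of [y] spoils at most three of the at least four points of [W]. *)
Lemma quarter_fix y : #[y]%g != 3 -> 3 <= #|orbs y 1| -> quarter y.
Proof.
move=> y3 /fixed_cycle[a [S [a3 ya aS S3]]] W W3.
exists a, 3, (W :\: S); split; first by split; rewrite // eq_sym.
split=> //; first exact: subsetDl.
  have := cardsID S W; have := subset_leq_card (subsetIr W S); lia.
by apply: subset_trans aS _; apply/subsetP => t tS; rewrite !inE negb_and negbK tS.
Qed.

(** The chain has orders [q], [r], 2, [r'], [q'] with [r] and [r'] odd. From 52 points, [W1] keeps
    at least 13 and [W2] at least four, enough for a double transposition. *)
Lemma quarter_reach y y' q q' : 51 < #|T| -> prime_elt y q -> prime_elt y' q' ->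
  quarter y -> quarter y' -> reachA 8 y y'.
Proof.
move=> T51 yq y'q' Qy Qy'.
have [|a [r [W1 [[ar r2 ry] [ya _ cW1 aW1]]]]] := Qy setT; first by rewrite cardsT; lia.
rewrite cardsT in cW1.
have [|a' [r' [W2 [[ar' r'2 r'y] [ya' sW2 cW2 aW2]]]]] := Qy' W1; first by lia.
have [||c c2 cW] := @small_elt 2 W2; [by [] | by rewrite /blk /=; lia|].
have [_ yE _] := yq; have [_ yE' _] := y'q'.
apply: (@reach_trans _ _ 6 2 _ a'); last first.
  by apply: reach_prime ar' y'q' _ _; rewrite -?yE' //; apply: commute_sym.
apply: (reach3 yq ar c2 ar'); rewrite -?yE // 1?eq_sym //.
  exact: disjoint_commute aW1 cW sW2.
exact/commute_sym/(disjoint_commute aW2 cW).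
Qed.

(** The chain has orders 3, 5, 2, 3. The involution moves at most 12 points, and [17 = 12 + 5]
    leaves five orbits of [y] off them. *)
Lemma three_reach y y' : prime_elt y 3 -> prime_elt y' 3 ->
  17 <= #|orbs y 3| -> 17 <= #|orbs y' 3| -> reachA 6 y y'.
Proof.
move=> y3 y'3 k17 k'17.
have [|O sO O4] := @subset_of_card _ (orbs y' 3) 4; first by lia.
have [//||b [bA b2 yb bO _]] := block_elt (r := 2) _ sO O4; first by [].
have cO := card_cover_orbs sO; rewrite O4 in cO.
have [|||a [aA a5 ya aO]] := @block_avoid_card _ y 3 5 (cover O) => //.
  by apply: leq_trans k17; rewrite (leq_add2l 5 _ 12).
apply: (@reach3 y a b y' 3 5 2 3) => //.
exact: disjoint_commute aO bO _.
Qed.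

Definition small y m := exists a r W, [/\ prime_elt a r, r != #[y]%g, commute y a,
  perm_on W a & #|W| <= m].

(** Some [r'] among 2, 3, 5 differs from [r] and [q']; its shift needs at most five orbits of [y'],
    and [W] meets at most [m]. *)
Lemma small_reach y y' q q' m s : prime_elt y q -> prime_elt y' q' -> small y m -> 0 < s ->
  m + 5 <= #|orbs y' s| -> reachA 6 y y'.
Proof.
move=> yq y'q' [a [r [W [ar ry ya aW Wm]]]] s_gt0 le_m.
have [r' [r'_pr r'r r'q' r'5]] : exists r', [/\ prime r', r' != r, r' != q' & blk r' <= 5].
  have [r2|r2] := eqVneq 2 r; first subst r.
    have [q3|q3] := eqVneq 3 q'; first by exists 5; rewrite -q3.
    by exists 3.
  have [q2|q2] := eqVneq 2 q'; last by exists 2.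
  by have [r3|r3] := eqVneq 3 r; [exists 5; rewrite -r3 -q2 | exists 3; rewrite -q2].
have [|b [bA br' yb bW]] := @block_avoid_card _ y' s r' W r'_pr s_gt0; first by lia.
have [_ yE _] := yq.
apply: (reach3 yq ar (b := b) (r' := r')) y'q' _ _ _ ya _ _ => //; rewrite -?yE 1?eq_sym //.
  exact/commute_sym/(disjoint_commute bW aW).
Qed.

(** The bound 12 is four orbits of size at most 3, for an involution commuting with [y] of order 3;
    for [q = 2] three orbits of size at most 2 suffice. *)
Lemma small_two_three y q : prime_elt y q -> q <= 3 -> 34 <= #|T| -> small y 12.
Proof.
move=> [q_pr yq yA] q3 T87; have nT := card_orbs q_pr yq.
have q1 := prime_gt1 q_pr.
pose r := if q == 2 then 3 else 2.
have r_pr : prime r by rewrite /r; case: ifP.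
have [s [s_gt0 sq ks]] : exists s, [/\ 0 < s, s <= q & blk r <= #|orbs y s|].
  have r4 : blk r <= 4 by rewrite /r; case: ifP.
  have [f4|f4] := leqP 4 #|orbs y 1|; first by exists 1; split=> //; lia.
  by exists q; split=> //; nia.
have [O sO cO] := subset_of_card ks.
have [a [aA ar ya aO _]] := block_elt r_pr sO cO s_gt0.
exists a, r, (cover O); split=> //.
  by rewrite yq /r; case: (eqVneq q 2) => [->|] //; rewrite eq_sym.
apply: leq_trans (card_cover_orbs sO) _; rewrite cO /r.
by case: (eqVneq q 2) => [q2|q2]; rewrite /blk /=; lia.
Qed.

(* Any three points of one orbit of y' lie in three orbits of y, whose union of
   size 3q therefore meets at most 3q - 2 orbits of y'. *)
Lemma shared_orbit_reach y y' q q' : prime_elt y q -> prime_elt y' q' ->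
  3 < q -> 5 <= q' -> #|orbs y 1| <= 2 -> 3 <= #|orbs y q| ->
  3 * q + 2 <= #|orbs y' q'| -> reachA 6 y y'.
Proof.
move=> yq y'q' q3 q'5 f2 k3 k'.
have [[q_pr yE _] [q'_pr yE' _]] := (yq, y'q').
have /card_gt0P[B /orbsP[t0 BE cB]] : 0 < #|orbs y' q'| by lia.
pose F := [set t | #|porbit y t| == 1].
have cF : #|F| <= 2 by rewrite orbs_cover_card mul1n.
(* [B] has [q' >= 5] points, of which [y] fixes at most two. *)
have : 3 <= #|B :\: F|.
  have := cardsID F B; rewrite cB.
  have := subset_leq_card (subsetIr B F); lia.
case/subset_of_card=> S sS cS.
pose P := [set porbit y t | t in S].
have sP : P \subset orbs y q.
  apply/subsetP=> _ /imsetP[t /(subsetP sS) tS ->]; apply/orbsP; exists t => //.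
  have : #|porbit y t| %| q by rewrite -yE -expg_porbit_fix expg_order perm1.
  by case/primeP: q_pr => _ /[apply] /orP[|/eqP//]; move: tS; rewrite !inE => /andP[/negPf->].
have P3 : #|P| <= 3 by rewrite -cS leq_imset_card.
have [|Q sQ cQ] := @subset_of_card _ (orbs y q :\: P) (3 - #|P|).
  by rewrite cardsD (setIidPr sP) leq_sub2r.
pose O := P :|: Q.
have sO : O \subset orbs y q.
  by rewrite subUset sP (subset_trans sQ) ?subsetDl.
have cO : #|O| = 3.
  rewrite cardsU; have -> : P :&: Q = set0.
    by apply/setP => A; rewrite !inE; apply/negP => /andP[AP /(subsetP sQ)]; rewrite inE AP.
  by rewrite cards0 cQ; lia.
have [//||a [aA ar ya aO _]] := block_elt (r := 3) _ sO cO; first by lia.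
pose W := cover O.
have SW : S \subset W.
  by apply/subsetP => t tS; rewrite (in_cover_orbs _ sO) inE imset_f.
have imW : #|[set porbit y' t | t in W]| + 2 <= 3 * q.
  have imS : [set porbit y' t | t in W] \subset porbit y' t0 |: [set porbit y' t | t in W :\: S].
    apply/subsetP=> _ /imsetP[t tW ->]; rewrite !inE.
    have [tS|tS] := boolP (t \in S); last by rewrite imset_f ?orbT // inE tS.
    by move: (subsetP sS t tS); rewrite inE BE -eq_porbit_mem => /andP[_ ->].
  have WS : #|W :\: S| + 3 <= 3 * q.
    rewrite cardsD (setIidPr SW) cS subnK; last by rewrite -cS subset_leq_card.
    by have := card_cover_orbs sO; rewrite cO.
  apply: leq_trans WS; rewrite -[3]/(1 + 2) addnA leq_add2r addnC.
  apply: leq_trans (subset_leq_card imS) _; rewrite cardsU1.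
  by rewrite leq_add ?leq_b1 ?leq_imset_card.
(* An involution needs four orbits of [y'] off [W], and [4 + (3 * q - 2) = 3 * q + 2]. *)
have [|||b [bA b2 yb bW]] := @block_avoid _ y' q' 2 W; [by [] | exact: prime_gt0 | | ].
  by apply: leq_trans k'; rewrite -[blk 2]/(2 + 2) -addnA addnC leq_add2r addnC.
apply: (@reach3 y a b y' q 3 2 q') => //; try by lia.
  exact/commute_sym/(disjoint_commute bW aO).
Qed.

End Reachable.

(** * The upper bounds 11 and 8 *)

Section Diameter.

Variable T : finType.
Implicit Types (x y : {perm T}).
Local Notation reachA := (reach ('Alt_T)%G).

Lemma Alt_cycle x y : x \in ('Alt_T)^#%g -> y \in <[x]>%g -> y \in ('Alt_T)%g.
Proof. by case/setD1P => _ xA; apply: subsetP; rewrite cycle_subG. Qed.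

Lemma reach_prime_power x y q : x \in ('Alt_T)^#%g -> y \in <[x]>%g -> prime_elt y q ->
  reachA 1 x y.
Proof. by move=> xA yx /prime_elt_neq1/setD1P[y1 _]; apply: reach_power. Qed.

(* In the second case x is a product of three q-cycles with at most two fixed
   points, and s permutes these cycles. *)
Lemma quarter_or_three x : 51 < #|T| ->
  (forall f q, f <= 2 -> prime q -> #|T| <> f + q /\ #|T| <> f + 2 * q) ->
  x \in ('Alt_T)^#%g ->
  (exists y q, [/\ prime_elt y q, reachA 1 x y & quarter y]) \/
  (exists s, [/\ prime_elt s 3, reachA 2 x s & 17 <= #|orbs s 3|]).
Proof.
move=> T51 nq xA; have [x1 xAlt] := setD1P xA.
have [|[y yx [q [q_pr yq fk]]]|[q [q_pr xq f3 k3]]] := @powers_dichotomy T x 3 x1; first by lia.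
  have yP : prime_elt y q by split=> //; apply: Alt_cycle yx.
  left; exists y, q; split=> //; first exact: reach_prime_power yx yP.
  have nT := card_orbs q_pr yq.
  (* For [q = 3] a shift of order 5 is used: 52 points give ten fixed points or ten 3-cycles. *)
  have [q3|q3] := eqVneq q 3.
    rewrite q3 in yq nT; have [f10|f10] := leqP 10 #|orbs y 1|.
      by apply: (@quarter_ten _ y 1) => //; rewrite yq.
    by apply: (@quarter_ten _ y 3); rewrite ?yq //; lia.
  case/orP: fk => fk; first by apply: (@quarter_four _ y 1); rewrite ?yq.
  by apply: (@quarter_four _ y q); rewrite ?yq // prime_gt0.
have nT := card_orbs q_pr xq; have k0 := orbs_prime_gt0 q_pr xq.
have xP : prime_elt x q by [].
have q3 : q != 3 by apply/eqP => q3; rewrite q3 in nT k3; lia.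
have [f_gt2|f2] := leqP 3 #|orbs x 1|.
  left; exists x, q; split=> //; first by apply: reach_prime_power xP; rewrite ?cycle_id.
  by apply: quarter_fix; rewrite ?xq.
(* One or two [q]-cycles would make [#|T| - f] equal to [q] or [2 * q] for some [f <= 2]. *)
have k_eq3 : #|orbs x q| = 3.
  have [] := nq #|orbs x 1| q f2 q_pr.
  by move: k0 k3 nT; case: #|orbs x q| => [|[|[|[|k]]]] // _ _ ->; lia.
have [//||s [sA s3 xs sO sf]] := block_elt (r := 3) _ (subxx _) k_eq3; first exact: prime_gt0.
have sP : prime_elt s 3 by [].
right; exists s; split=> //; first by apply: reach_prime xP sP _ _.
have nT' := card_orbs (isT : prime 3) s3.
(* [s] moves every point that [x] moves, so it fixes at most two of at least 52 points and has at
   least 17 3-cycles. *)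
have : #|orbs s 1| <= #|orbs x 1|.
  rewrite -[#|orbs s 1|]mul1n -[#|orbs x 1|]mul1n -!orbs_cover_card.
  apply: subset_leq_card; apply/subsetP=> t; rewrite !inE => st.
  have {st} st : s t = t.
    have := expg_porbit_fix s t 1; rewrite expg1 dvdn1 st; exact/eqP.
  have : #|porbit x t| %| q by rewrite -xq -expg_porbit_fix expg_order perm1.
  have [_ /(_ _)/[apply]/orP[//|/eqP tq]] := primeP q_pr.
  have /sf : t \in cover (orbs x q).
    by rewrite (in_cover_orbs _ (subxx _)); apply/orbsP; exists t.
  by rewrite st eqxx.
by lia.
Qed.

(** The worst case is the mixed one, [1 + 8 + 2]: an [s] of order 3 with 17 orbits of size 3
    satisfies [quarter] through shifts of order 5. *)
Lemma reach_11 x x' : 51 < #|T| ->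
  (forall f q, f <= 2 -> prime q -> #|T| <> f + q /\ #|T| <> f + 2 * q) ->
  x \in ('Alt_T)^#%g -> x' \in ('Alt_T)^#%g -> reachA 11 x x'.
Proof.
move=> T51 nq xA x'A.
have [[y [q [yq xy Qy]]]|[s [s3 xs ks]]] := quarter_or_three T51 nq xA;
have [[y' [q' [yq' xy' Qy']]]|[s' [s'3 xs' ks']]] := quarter_or_three T51 nq x'A.
- apply: (@reach_leq _ _ (1 + (8 + 1))) => //; apply: reach_trans xy _.
  by apply: reach_trans (reach_sym xy'); apply: quarter_reach yq yq' Qy Qy'.
- have Qs' : quarter s' by apply: (@quarter_ten _ s' 3); have [_ s'E _] := s'3; rewrite ?s'E //; lia.
  apply: (@reach_leq _ _ (1 + (8 + 2))) => //; apply: reach_trans xy _.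
  by apply: reach_trans (reach_sym xs'); apply: quarter_reach yq s'3 Qy Qs'.
- have Qs : quarter s by apply: (@quarter_ten _ s 3); have [_ sE _] := s3; rewrite ?sE //; lia.
  apply: (@reach_leq _ _ (2 + (8 + 1))) => //; apply: reach_trans xs _.
  by apply: reach_trans (reach_sym xy'); apply: quarter_reach s3 yq' Qs Qy'.
apply: (@reach_leq _ _ (2 + (6 + 2))) => //; apply: reach_trans xs _.
by apply: reach_trans (reach_sym xs'); apply: three_reach.
Qed.

Section SmallPrimes.

Variable p : nat.
Hypotheses (p_ge5 : 5 <= p) (T_large : p * (3 * p + 2) + 2 <= #|T|).
Hypothesis p_max : forall q k f, prime q -> f <= 2 -> #|T| = f + q * k -> q <= p.

(** The value at [p = 5]: [5 * 17 + 2 = 87]. *)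
Let T87 : 87 <= #|T|.
Proof. by nia. Qed.

(** Fewer orbits of size [q <= p] would give at most [p * (3 * p + 1) + 2] points. *)
Lemma few_fixed_many_orbs y q : prime_elt y q -> #|orbs y 1| <= 2 ->
  q <= p /\ 3 * p + 2 <= #|orbs y q|.
Proof.
move=> [q_pr yq yA] f2; have nT := card_orbs q_pr yq.
have qp := p_max q_pr f2 nT; split=> //.
have := prime_gt0 q_pr; rewrite leqNgt => q0; apply/negP => k_lt.
have : q * #|orbs y q| <= p * (3 * p + 1) by apply: leq_mul => //; lia.
by nia.
Qed.

(** Eight is [3 + 5], what [small_reach] needs against a 3-cycle. *)
Definition rich y := exists2 s, 0 < s & 8 <= #|orbs y s|.

Lemma small_of_fixed y q : prime_elt y q -> q != 3 -> 3 <= #|orbs y 1| -> small y 3.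
Proof.
move=> [q_pr yq yA] q3 /fixed_cycle[a [W [a3 ya aW W3]]].
by exists a, 3, W; split; rewrite // yq eq_sym.
Qed.

Lemma rich_reach y y' q q' : prime_elt y q -> prime_elt y' q' -> rich y -> rich y' ->
  reachA 6 y y'.
Proof.
move=> yq y'q' [s s_gt0 ys] [s' s'_gt0 ys'].
have [/andP[q3 f3]|ty] := boolP ((q != 3) && (3 <= #|orbs y 1|)).
  by apply: small_reach yq y'q' (small_of_fixed yq q3 f3) s'_gt0 _.
have [/andP[q'3 f'3]|ty'] := boolP ((q' != 3) && (3 <= #|orbs y' 1|)).
  by apply/reach_sym/(small_reach y'q' yq (small_of_fixed y'q' q'3 f'3) s_gt0).
(* Seventeen is [12 + 5], what [small_reach] needs after [small_two_three]. When both orders exceed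
   3, [shared_orbit_reach] applies instead, since [3 * q + 2 <= 3 * p + 2]. *)
have many (z : {perm T}) r : prime_elt z r -> ~~ ((r != 3) && (3 <= #|orbs z 1|)) ->
    exists2 t, 0 < t & 17 <= #|orbs z t|.
  move=> zr; rewrite negb_and negbK -ltnNge => /orP[/eqP r3|f2].
    rewrite r3 in zr; have [_ z3 _] := zr; have nT := card_orbs (isT : prime 3) z3.
    have [f17|f17] := leqP 17 #|orbs z 1|; [by exists 1 | exists 3 => //]. lia.
  have [_ k] := few_fixed_many_orbs zr f2; exists r; last by lia.
  by have [/prime_gt0] := zr.
have [q3|q3] := leqP q 3.
  have [t t_gt0 kt] := many _ _ y'q' ty'.
  by apply: small_reach yq y'q' (small_two_three yq q3 _) t_gt0 kt; lia.
have [q'3|q'3] := leqP q' 3.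
  have [t t_gt0 kt] := many _ _ yq ty.
  by apply/reach_sym; apply: small_reach y'q' yq (small_two_three y'q' q'3 _) t_gt0 kt; lia.
have f2 : #|orbs y 1| <= 2 by move: ty; rewrite negb_and -ltnNge; lia.
have f'2 : #|orbs y' 1| <= 2 by move: ty'; rewrite negb_and -ltnNge; lia.
have [qp k] := few_fixed_many_orbs yq f2.
have [q'p k'] := few_fixed_many_orbs y'q' f'2.
have q'5 : 5 <= q'.
  by have [q'_pr _ _] := y'q'; rewrite ltn_neqAle q'3 andbT; apply: contraTneq q'_pr => <-.
by apply: shared_orbit_reach yq y'q' _ _ _ _ _; lia.
Qed.

(** In the second case of the dichotomy with [K = 7], [x] itself has prime order and at most seven
    orbits of size [q]. With at most two fixed points it would have [3 * p + 2] of them. *)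
Lemma rich_or_small x : x \in ('Alt_T)^#%g ->
  (exists y q, [/\ prime_elt y q, reachA 1 x y & rich y]) \/
  (exists q, [/\ prime_elt x q, q != 3 & 3 <= #|orbs x 1|]).
Proof.
move=> xA; have [x1 xAlt] := setD1P xA.
have [|[y yx [q [q_pr yq fk]]]|[q [q_pr xq f7 k7]]] := @powers_dichotomy T x 7 x1; first by lia.
  have yP : prime_elt y q by split=> //; apply: Alt_cycle yx.
  left; exists y, q; split=> //; first exact: reach_prime_power yx yP.
  by case/orP: fk; [exists 1 | exists q; rewrite ?prime_gt0].
right; exists q; split=> //.
  by apply/eqP => q3; have := card_orbs q_pr xq; rewrite q3 in k7 *; lia.
rewrite leqNgt; apply/negP => f2.
by have [||_] := @few_fixed_many_orbs x q; [ | | lia].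
Qed.

(** The longest cases are [1 + 6 + 1] and, when both ends have prime order and three fixed points,
    the 8 of [quarter_reach]. *)
Lemma reach_8 x x' : x \in ('Alt_T)^#%g -> x' \in ('Alt_T)^#%g -> reachA 8 x x'.
Proof.
move=> xA x'A.
have [[y [q [yq xy ry]]]|[q [xq q3 f3]]] := rich_or_small xA;
have [[y' [q' [yq' xy' ry']]]|[q' [xq' q'3 f'3]]] := rich_or_small x'A.
- rewrite -[8]/(1 + (6 + 1)); apply: reach_trans xy _.
  by apply: reach_trans (reach_sym xy'); apply: rich_reach yq yq' _ _.
- apply: (@reach_leq _ _ (1 + 6)) => //; apply: reach_trans xy _; apply: reach_sym.
  by have [s s0 ks] := ry; apply: small_reach xq' yq (small_of_fixed xq' q'3 f'3) s0 ks.
- apply: (@reach_leq _ _ (6 + 1)) => //; apply: reach_trans (reach_sym xy').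
  by have [s s0 ks] := ry'; apply: small_reach xq yq' (small_of_fixed xq q3 f3) s0 ks.
have [[_ xE _] [_ x'E _]] := (xq, xq').
by apply: quarter_reach xq xq' _ _; [lia| |]; apply: quarter_fix; rewrite ?xE ?x'E.
Qed.

End SmallPrimes.

End Diameter.

(** * Prime factors of three consecutive integers, and conclusion *)

Lemma prime_ge5_dvd_consecutive n : 51 < n ->
  exists2 q, prime q & (5 <= q) && (q %| n * (n - 1) * (n - 2)).
Proof.
move=> n51.
suff [d [d1 d2 d3 dn]] : exists d, [/\ 1 < d, ~~ (2 %| d), ~~ (3 %| d)
    & d %| n * (n - 1) * (n - 2)].
  have q_pr := pdiv_prime d1; exists (pdiv d) => //.
  rewrite (dvdn_trans (pdiv_dvd d) dn) andbT.
  move: (pdiv_dvd d) (q_pr); case: (pdiv d) => [|[|[|[|[|q]]]]] //= qd _.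
    by rewrite qd in d2.
  by rewrite qd in d3.
have dv0 d : d %| n -> d %| n * (n - 1) * (n - 2) by move=> h; rewrite !dvdn_mulr.
have dv1 d : d %| n - 1 -> d %| n * (n - 1) * (n - 2).
  by move=> h; rewrite dvdn_mulr ?dvdn_mull.
have dv2 d : d %| n - 2 -> d %| n * (n - 1) * (n - 2) by move=> h; rewrite dvdn_mull.
(* For [n] odd, [n] or [n - 2] is prime to 6. For [n] even, [n - 1] is, unless 3 divides it; then 3
   divides neither [n] nor [n - 2], and one of these has an odd half. *)
have [n_odd|n_even] := boolP (2 %| n - 1).
  have [n3|n3] := boolP (3 %| n).
    by exists (n - 2); split; [lia|lia|lia|exact: dv2].
  by exists n; split; [lia|lia|lia|exact: dv0].
have [n3|n3] := boolP (3 %| n - 1); last by exists (n - 1); split; [lia|lia|lia|exact: dv1].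
have [n4|n4] := boolP (4 %| n).
  exists ((n - 2) %/ 2); split; [lia|lia|lia|]; apply/dv2/dvdn_div; lia.
exists (n %/ 2); split; [lia|lia|lia|]; apply/dv0/dvdn_div; lia.
Qed.

Theorem theorem3p8 (n p : nat)
    (n_gt51 : 51 < n)
    (n_nprime : ~~ prime n)
    (n1_nprime : ~~ prime (n - 1))
    (n2_nprime : ~~ prime (n - 2))
    (n_half_nprime : forall q : nat, prime q -> n <> 2 * q)
    (n1_half_nprime : forall q : nat, prime q -> n - 1 <> 2 * q)
    (n2_half_nprime : forall q : nat, prime q -> n - 2 <> 2 * q)
    (conn : connected_graph (proper_power_graph ('Alt_('I_n))%g))
    (p_def : p = max_pdiv (n * (n - 1) * (n - 2))) :
  (3 * p + 2 <= (n - 2) %/ p ->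
     6 <= diam (proper_power_graph ('Alt_('I_n))%g) <= 8) /\
  (~ (3 * p + 2 <= (n - 2) %/ p) ->
     6 <= diam (proper_power_graph ('Alt_('I_n))%g) <= 11).
Proof.
have cT := card_ord n.
have d6 : 6 <= diam (proper_power_graph ('Alt_('I_n))%g).
  by apply: diam_Alt_gt5 => //; rewrite cT; lia.
rewrite d6; split=> [p_small | _]; apply: (@diam_leq _ ('Alt_('I_n))%G) => x x' xA x'A.
  have n3_gt0 : 0 < n * (n - 1) * (n - 2) by rewrite !muln_gt0; lia.
  have p_max q : prime q -> q %| n * (n - 1) * (n - 2) -> q <= p.
    by move=> q_pr qn; rewrite p_def max_pdiv_max // mem_primes q_pr n3_gt0.
  have p5 : 5 <= p.
    have [q q_pr /andP[q5 qn]] := prime_ge5_dvd_consecutive n_gt51.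
    exact: leq_trans q5 (p_max q q_pr qn).
  apply: (reach_8 p5) => //; rewrite cT.
    move: p_small; rewrite leq_divRL ?(leq_trans _ p5) // mulnC; lia.
  move=> q k f q_pr f2 nE; apply: p_max => //.
  (* With [f <= 2] fixed points, [q] divides one of [n], [n - 1], [n - 2]. *)
  have qf : q %| n - f by rewrite nE addKn dvdn_mulr.
  case: f f2 qf {nE} => [|[|[|f]]] // _; rewrite ?subn0 => qf.
  - by rewrite -mulnA dvdn_mulr.
  - by rewrite dvdn_mulr // dvdn_mull.
  - by rewrite dvdn_mull.
apply: reach_11 => //; rewrite ?cT // => f q f2 q_pr.
have := conj (n_half_nprime q q_pr) (conj (n1_half_nprime q q_pr) (n2_half_nprime q q_pr)).
have nq m : ~~ prime m -> m <> q by move=> mP mq; rewrite mq q_pr in mP.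
have := conj (nq _ n_nprime) (conj (nq _ n1_nprime) (nq _ n2_nprime)).
by lia.
Qed.
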